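(* Let $G$ be a finitary clone on a finite set $A$. Then the finitary centralizer $G^{\perp(\aleph_0)}$ is the set of all finitary operations $f:A^n \rightarrow A$ $(n \in \aleph_0)$ such that $h(f) = f\bigl(\bigl(h(\pi_i)\bigr)_{i \in n}\bigr)$ for every operation $h:A^{(A^n)} \rightarrow A$ of arity $A^n$ in $G$, where $\pi_i:A^n \rightarrow A$ denotes the projection $(i \in n)$.
   Context: A finitary operation on a set $A$ is a map $A^n\to A$ with $n$ a finite cardinal ($n=\{0,\dots,n-1\}$; $n=0$ is allowed). A finitary clone on $A$ is a set $F$ of finitary operations on $A$ that contains all projections $\pi_i:A^n\to A$ and is such that for every $f:A^m\to A$ in $F$ and every family $g_j:A^n\to A$ $(j\in m)$ in $F$, the composite $f\circ(g_j)_{j\in m}:A^n\to A$ lies in $F$. Operations $f:A^n\to A$ and $g:A^m\to A$ commute, written $f\perp g$, if for every matrix $a=(a_{ij})\in A^{n\times m}$ one has $g\bigl((f((a_{ij})_{i\in n}))_{j\in m}\bigr)=f\bigl((g((a_{ij})_{j\in m}))_{i\in n}\bigr)$. For a set $G$ of finitary operations on $A$, the finitary centralizer $G^{\perp(\aleph_0)}$ is the set of all finitary operations $f$ on $A$ with $f\perp g$ for all $g\in G$. Convention: since $A$ is finite, the finite set $A^n$ is identified with its cardinality. Thus ''an operation $h:A^{(A^n)}\to A$ of arity $A^n$ in $G$'' means a map $h:A^{(A^n)}\to A$ such that, for a chosen bijection $\phi:k\to A^n$ with $k$ the cardinality of $A^n$, the corresponding operation $A^k\cong A^{(A^n)}\xrightarrow{h}A$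 (reindexing along $\phi$) lies in $G$; since $G$ is a clone, this does not depend on the choice of $\phi$. In $h(f)$, the map $f:A^n\to A$ is regarded as an element of $A^{(A^n)}$. *)

(* Defs.v *)
From mathcomp Require Import all_boot matrix.

Set Implicit Arguments.
Unset Strict Implicit.
Unset Printing Implicit Defensive.

(* Maps A^X -> A, for X a finite set of arguments; an n-ary operation is the
   case X = 'I_n.  Since A^X is itself finite, finite functions are used
   throughout, so that equality of operations is extensional.  In particular
   an n-ary operation A^n -> A literally is an element of A^(A^n). *)
Definition operation (X A : finType) := {ffun {ffun X -> A} -> A}.

Definition finitary_ops (A : finType) := forall n : nat, operation 'I_n A -> Prop.

Definition op_proj (X A : finType) (x : X) : operation X A :=
  [ffun a : {ffun X -> A} => a x].

Definition op_comp (A : finType) (m n : nat)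
    (f : operation 'I_m A) (g : 'I_m -> operation 'I_n A) : operation 'I_n A :=
  [ffun a : {ffun 'I_n -> A} => f [ffun j => g j a]].

Record finitary_clone (A : finType) (F : finitary_ops A) : Prop := {
  clone_proj : forall (n : nat) (i : 'I_n), F n (op_proj A i);
  clone_comp : forall (m n : nat)
      (f : operation 'I_m A) (g : 'I_m -> operation 'I_n A),
    F m f -> (forall j, F n (g j)) -> F n (op_comp f g)
}.

Definition commute (A : finType) (n m : nat)
    (f : operation 'I_n A) (g : operation 'I_m A) : Prop :=
  forall a : 'M[A]_(n, m),
    g [ffun j => f [ffun i => a i j]] = f [ffun i => g [ffun j => a i j]].

Definition finitary_centralizer (A : finType) (G : finitary_ops A) :
    finitary_ops A :=
  fun n f => forall (m : nat) (g : operation 'I_m A), G m g -> commute f g.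

(* The operation A^k ~ A^X -> A obtained from h : A^X -> A and a bijection
   between k and X, given here by its direction psi : X -> 'I_k. *)
Definition reindex_op (A X : finType) (k : nat) (psi : X -> 'I_k)
    (h : operation X A) : operation 'I_k A :=
  [ffun a : {ffun 'I_k -> A} => h [ffun x => a (psi x)]].

(* The chosen bijection is the enumeration of X; for a clone the choice is
   immaterial, see in_opsP. *)
Definition in_ops (A : finType) (G : finitary_ops A) (X : finType)
    (h : operation X A) : Prop :=
  G #|X| (reindex_op (@enum_rank X) h).

Lemma clone_reindex (A X : finType) (G : finitary_ops A) (k l : nat)
    (psi : X -> 'I_k) (chi : X -> 'I_l) (h : operation X A) :
  finitary_clone G -> bijective psi ->
  G k (reindex_op psi h) -> G l (reindex_op chi h).
Proof.
move=> cG [phi psiK phiK] Gh.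
suff -> : reindex_op chi h =
    op_comp (reindex_op psi h) (fun j => op_proj A (chi (phi j))).
  by apply: clone_comp => // j; apply: clone_proj.
apply/ffunP=> a; rewrite !ffunE; congr (h _).
by apply/ffunP=> x; rewrite !ffunE psiK.
Qed.

Lemma in_opsP (A X : finType) (G : finitary_ops A) (k : nat)
    (psi : X -> 'I_k) (h : operation X A) :
  finitary_clone G -> bijective psi ->
  in_ops G h <-> G k (reindex_op psi h).
Proof.
by move=> cG bpsi; split; apply: clone_reindex => //; apply: enum_rank_bij.
Qed.

(* Main.v *)
Require Import Defs.
From mathcomp Require Import all_boot matrix.

(* Commutation of f with h, tested on the matrix whose columns are all of A^n,
   is exactly the stated identity.  Conversely a matrix a with m columns turns
   an m-ary g in G into the operation u |-> g (u (a_j))_j of arity A^n, again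
   in G, and the identity for it is commutation of f and g at a. *)

Theorem corollary5p8 (A : finType) (G : finitary_ops A) (hG : finitary_clone G)
    (n : nat) (f : operation 'I_n A) :
  finitary_centralizer G f <->
  (forall h : operation {ffun 'I_n -> A} A,
     in_ops G h -> h f = f [ffun i => h (op_proj A i)]).
Proof.
split=> [fG h Gh | fP m g Gg a].
  pose a : 'M[A]_(n, #|{ffun 'I_n -> A}|) :=
    (\matrix_(i, j) (enum_val j : {ffun 'I_n -> A}) i)%R.
  transitivity (f [ffun i => reindex_op (@enum_rank _) h [ffun j => a i j]]).
    (* Applying [f] to every column of [a] lists all values of [f], so commutation at [a] turns the
       right side into [h f]. *)
    rewrite -(fG _ _ Gh a) ffunE; congr (h _); apply/ffunP=> x; rewrite !ffunE.
    by congr (f _); apply/ffunP=> i; rewrite !ffunE mxE enum_rankK.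
  (* Row [i] of [a] lists the values of the projection [op_proj A i]. *)
  congr (f _); apply/ffunP=> i; rewrite !ffunE; congr (h _).
  by apply/ffunP=> x; rewrite !ffunE mxE enum_rankK.
pose col j : {ffun 'I_n -> A} := [ffun i => a i j].
pose h : operation {ffun 'I_n -> A} A :=
  [ffun u : {ffun {ffun 'I_n -> A} -> A} => g [ffun j => u (col j)]].
have Gh : in_ops G h.
  rewrite /in_ops.
  (* Each argument of [g] reads one coordinate, that of a column of [a]; repeated columns do no
     harm. *)
  have -> : reindex_op (@enum_rank _) h =
      op_comp g (fun j => op_proj A (enum_rank (col j))).
    apply/ffunP=> u; rewrite !ffunE; congr (g _).
    by apply/ffunP=> j; rewrite !ffunE.
  by apply: (clone_comp hG) => // j; apply: (clone_proj hG).
(* [h f] unfolds to [g] of the values of [f] at the columns; it remains that [op_proj A i] takes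
   [col j] to [a i j]. *)
have := fP h Gh; rewrite ffunE => ->; congr (f _).
apply/ffunP=> i; rewrite !ffunE; congr (g _).
by apply/ffunP=> j; rewrite !ffunE.
Qed.
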